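(* Let $\kappa\ge1$ and let $M,n$ be integers with $2\log_2M\le n$. Assume the input space $\mathcal{X}$ is infinite. There exist a constant $C>0$, depending only on $\kappa$ and $c$, and a set of prediction rules $\mathcal{F}=\{f_1,\dots,f_M\}$ (functions $\mathcal{X}\to\{-1,1\}$) such that for any real-valued procedure $\bar f_n$ (a measurable function of $X$ and the sample $D_n$) there exists a probability measure $\pi$ satisfying $\mathrm{MA}(\kappa)$ for which $$\mathbb{E}[A(\bar f_n)-A^*]\ge \min_{f\in\mathcal{C}}(A(f)-A^* )+C\left(\sqrt{\frac{(\min_{f\in\mathcal{C}}A(f)-A^* )^{1/\kappa}\log M}{n}}+\left(\frac{\log M}{n}\right)^{\kappa/(2\kappa-1)}\right),$$ where $\mathcal{C}$ is the convex hull of $\mathcal{F}$, $C=c^\kappa(4e)^{-1}2^{-2\kappa(\kappa-1)/(2\kappa-1)}(\log2)^{-\kappa/(2\kappa-1)}$, and $c>0$ is the constant in the margin assumption for hinge risk $\mathrm{MAH}(\kappa)$.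
   Context: $(X,Y)$ is a random pair on $\mathcal{X}\times\{-1,1\}$ with distribution $\pi$, $D_n$ consists of $n$ i.i.d. copies. $\eta(x)=\mathbb{P}(Y=1\mid X=x)$, $f^*=\mathrm{sign}(2\eta-1)$, $R(f)=\mathbb{P}(Y\ne f(X))$, $R^*=R(f^* )$. Hinge risk $A(f)=\mathbb{E}[\max(1-Yf(X),0)]$ for real-valued $f$, $A^*=\inf_fA(f)$. $\mathrm{MA}(\kappa)$: exists $c_0>0$ with $\mathbb{E}|f(X)-f^*(X)|\le c_0(R(f)-R^* )^{1/\kappa}$ for all measurable $f:\mathcal{X}\to\{-1,1\}$. $\mathrm{MAH}(\kappa)$ with constant $c>0$: $\mathbb{E}|f(X)-f^*(X)|\le c(A(f)-A^* )^{1/\kappa}$ for all measurable $f:\mathcal{X}\to[-1,1]$. The expectation is over $D_n$ under $\pi$.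
   Formalization: The infinite input space is also assumed to have all single points measurable (with the trivial sigma-algebra the claim fails), and c is read as some constant depending only on kappa for which the measure pi satisfies MAH(kappa). *)

(* Defs.v *)
From HB Require Import structures.
From mathcomp Require Import all_boot all_order all_algebra.
From mathcomp Require Import all_classical all_reals all_analysis.
Set Implicit Arguments. Unset Strict Implicit. Unset Printing Implicit Defensive.
Import Order.TTheory GRing.Theory Num.Theory.
Import numFieldNormedType.Exports.
Local Open Scope classical_set_scope.
Local Open Scope ring_scope.

Section Classif.
Context {R : realType} {d : measure_display} {X : measurableType d}.

Definition lab (b : bool) : R := if b then 1 else -1.

Definition pm1_fun (f : X -> R) : Prop := forall x, f x = 1 \/ f x = -1.

Definition unit_interval_fun (f : X -> R) : Prop := forall x, -1 <= f x <= 1.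

Variable P : probability (X * bool)%type R.

(* eta is a version of eta(x) = P(Y = 1 | X = x) *)
Definition is_eta (eta : X -> R) : Prop :=
  measurable_fun setT eta /\ (forall x, 0 <= eta x <= 1) /\
  forall A : set X, measurable A ->
    P (A `*` [set true]) = (\int[P]_z (\1_A z.1 * eta z.1)%:E)%E.

Definition fstar (eta : X -> R) (x : X) : R := if 1/2 <= eta x then 1 else -1.

Definition risk (f : X -> R) : \bar R := P [set z | f z.1 != lab z.2].

(* Rstar = R(fstar) : infimum over measurable prediction rules *)
Definition risk_star : \bar R :=
  ereal_inf [set risk f | f in [set f | measurable_fun setT f /\ pm1_fun f]].

Definition hinge (f : X -> R) : \bar R :=
  (\int[P]_z (Num.max (1 - lab z.2 * f z.1) 0)%:E)%E.

Definition hinge_star : \bar R :=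
  ereal_inf [set hinge f | f in [set f : X -> R | measurable_fun setT f]].

Definition dist_fstar (eta : X -> R) (f : X -> R) : \bar R :=
  (\int[P]_z `|f z.1 - fstar eta z.1|%:E)%E.

Definition MA (eta : X -> R) (kappa : R) : Prop :=
  exists c0 : R, 0 < c0 /\
    forall f : X -> R, measurable_fun setT f -> pm1_fun f ->
      (dist_fstar eta f <=
        (c0 * (fine (risk f) - fine risk_star) `^ kappa^-1)%:E)%E.

Definition MAH (eta : X -> R) (kappa c : R) : Prop :=
  forall f : X -> R, measurable_fun setT f -> unit_interval_fun f ->
    (dist_fstar eta f <=
      (c * (fine (hinge f) - fine hinge_star) `^ kappa^-1)%:E)%E.

(* E_{D_n}[g(D_n)] for D_n = n i.i.d. copies of (X,Y) ~ P, written as an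
   iterated integral against P (Tonelli: equals the integral against P^{(x)n}
   for nonnegative measurable g) *)
Fixpoint sampleE (n : nat) : (n.-tuple (X * bool) -> \bar R) -> \bar R :=
  match n return (n.-tuple (X * bool) -> \bar R) -> \bar R with
  | 0 => fun g => g [tuple]
  | n'.+1 => fun g => (\int[P]_z sampleE (fun t => g (cons_tuple z t)))%E
  end.

End Classif.

Definition conv_hull {R : realType} {X : Type} (M : nat) (F : 'I_M -> X -> R)
  : set (X -> R) :=
  [set g | exists lam : 'I_M -> R, (forall j, 0 <= lam j) /\
     \sum_(j < M) lam j = 1 /\ g = (fun x => \sum_(j < M) lam j * F j x)].

Definition lb_const {R : realType} (kappa c : R) : R :=
  c `^ kappa / (4 * expR 1)
  * 2 `^ (- (2 * kappa * (kappa - 1) / (2 * kappa - 1)))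
  * (ln 2) `^ (- (kappa / (2 * kappa - 1))).

(* Main.v *)
Require Import Defs.
From HB Require Import structures.
From mathcomp Require Import all_boot all_order all_algebra.
From mathcomp Require Import all_classical all_reals all_analysis.
From mathcomp Require Import measurable_realfun ring lra zify.
Import Order.TTheory GRing.Theory Num.Theory.
Import numFieldNormedType.Exports.
Local Open Scope classical_set_scope.
Local Open Scope ring_scope.

(** Let N be the integer part of log2 M and let the rules realise all sign
    patterns on N points of mass w, the remaining mass 1 - N w sitting at a
    point where the label is 1 almost surely. At the N points
    eta = (1 + s_j h) / 2 for a hidden sign pattern s, so the Bayes rule is one
    of the rules, the approximation error vanishes, and only the term
    (log M / n)^(kappa / (2 kappa - 1)) remains. Averaging over s reduces the
    lower bound to testing a single sign from n observations. Conditionally on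
    the number m of visits to the point, the squared Hellinger affinity is
    (1 - h^2)^m, which averages to (1 - w h^2)^n; when n w h^2 = 4/9 the two
    sample laws overlap by at least 1/3, hence the excess hinge risk is at least
    N w h / 3.
    MAH(kappa) holds with c^kappa = (3/2) 2^(kappa - 1) as soon as
    p = N w <= 1/3 and p^kappa <= (3/2) p h. The choice
    p = min (1/3, (N / n)^(1 / (2 kappa - 1))) meets all constraints; the
    comparison with the constant of the theorem then uses N >= (5/8) log2 M and
    e >= 27/10. *)

(** * Overlap of two sample laws *)

(* At [u = (1 - w h^2)^n] this bounds the L1 distance between [A] times and [B]
   times the two [n]-sample laws. *)
Definition overlap_defect {R : realType} (u A B : R) : R :=
  Num.sqrt ((A + B) ^+ 2 - 4 * A * B * u).

Lemma overlap_defectZ {R : realType} (u A B q : R) : 0 <= q ->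
  overlap_defect u (A * q) (B * q) = q * overlap_defect u A B.
Proof.
move=> q0; rewrite /overlap_defect.
have -> : (A * q + B * q) ^+ 2 - 4 * (A * q) * (B * q) * u
          = q ^+ 2 * ((A + B) ^+ 2 - 4 * A * B * u) by ring.
by rewrite sqrtrM ?sqr_ge0// sqrtr_sqr ger0_norm.
Qed.

(** After squaring, the claim is that the product of the two roots is at most [x * y - c]. Squared
    again, this is [c * (x - y) ^+ 2 >= 0]; the bound [c <= x * y] keeps the right side
    nonnegative. *)
Lemma sqrtD_hyperbolic {R : realType} (x y c : R) : 0 <= x -> 0 <= y -> 0 <= c ->
  c <= x ^+ 2 -> c <= y ^+ 2 ->
  Num.sqrt (x ^+ 2 - c) + Num.sqrt (y ^+ 2 - c)
    <= Num.sqrt ((x + y) ^+ 2 - 4 * c).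
Proof.
move=> x0 y0 c0 cx cy.
have cxy : c <= x * y.
  by rewrite -(@ler_pXn2r _ 2)// ?nnegrE ?mulr_ge0// expr2 exprMn ler_pM.
set a := Num.sqrt _; set b := Num.sqrt (y ^+ 2 - c).
have a2 : a ^+ 2 = x ^+ 2 - c by rewrite sqr_sqrtr// subr_ge0.
have b2 : b ^+ 2 = y ^+ 2 - c by rewrite sqr_sqrtr// subr_ge0.
have ab : a * b <= x * y - c.
  rewrite -(@ler_pXn2r _ 2)// ?nnegrE ?mulr_ge0 ?sqrtr_ge0 ?subr_ge0//.
  rewrite exprMn a2 b2; have := mulr_ge0 c0 (sqr_ge0 (x - y)); nra.
rewrite -(ger0_norm (addr_ge0 (sqrtr_ge0 _) (sqrtr_ge0 _))) -sqrtr_sqr.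
by apply: ler_wsqrtr; rewrite sqrrD -/a -/b a2 b2; nra.
Qed.

Lemma sqrt_concave {R : realType} (w a b : R) : 0 <= w <= 1 -> 0 <= a -> 0 <= b ->
  (1 - w) * Num.sqrt a + w * Num.sqrt b <= Num.sqrt ((1 - w) * a + w * b).
Proof.
move=> /andP[w0 w1] a0 b0.
set s := Num.sqrt a; set t := Num.sqrt b.
have <- : s ^+ 2 = a by rewrite sqr_sqrtr.
have <- : t ^+ 2 = b by rewrite sqr_sqrtr.
have v0 : 0 <= 1 - w by lra.
have st0 : 0 <= (1 - w) * s + w * t.
  by rewrite addr_ge0// mulr_ge0// sqrtr_ge0.
rewrite -(ger0_norm st0) -sqrtr_sqr; apply: ler_wsqrtr.
have := mulr_ge0 (mulr_ge0 w0 v0) (sqr_ge0 (s - t)); nra.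
Qed.

(* The location of the revealed point is common to both hypotheses (mass
   [1 - w]) or is the point at which they disagree, with label bias [h]. *)
Lemma overlap_defect_step {R : realType} (u w h A B : R) :
  0 <= u <= 1 -> 0 <= w <= 1 -> 0 <= h <= 1 -> 0 <= A -> 0 <= B ->
  (1 - w) * overlap_defect u A B
  + (overlap_defect u (A * (w * ((1 + h) / 2))) (B * (w * ((1 - h) / 2)))
     + overlap_defect u (A * (w * ((1 - h) / 2))) (B * (w * ((1 + h) / 2))))
  <= overlap_defect (u * (1 - w * h ^+ 2)) A B.
Proof.
move=> /andP[u0 u1] w01 /andP[h0 h1] A0 B0; have /andP[w0 w1] := w01.
have AB0 : 0 <= A * B by apply: mulr_ge0.
have [p0 m0] : 0 <= (1 + h) / 2 /\ 0 <= (1 - h) / 2 by split; lra.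
have h2 : h ^+ 2 <= 1 by rewrite expr_le1.
rewrite !mulrA.
rewrite [A * w * _ / 2](_ : _ = A * ((1 + h) / 2) * w); last by ring.
rewrite [B * w * _ / 2](_ : _ = B * ((1 - h) / 2) * w); last by ring.
rewrite [A * w * _ / 2](_ : _ = A * ((1 - h) / 2) * w); last by ring.
rewrite [B * w * _ / 2](_ : _ = B * ((1 + h) / 2) * w); last by ring.
rewrite !overlap_defectZ// -mulrDr.
set D2 := (X in w * X).
have uAB : 0 <= A * B * u <= A * B by rewrite mulr_ge0//= ler_piMr.
(* Both labels give the same product of weights, [A * B * (1 - h ^+ 2) / 4], and their sums of
   weights add up to [A + B]. So [sqrtD_hyperbolic] merges the two label branches into one
   defect. *)
have leD2 : D2 <= overlap_defect (u * (1 - h ^+ 2)) A B.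
  have := @sqrtD_hyperbolic _ (A * ((1 + h) / 2) + B * ((1 - h) / 2))
    (A * ((1 - h) / 2) + B * ((1 + h) / 2)) (A * B * (1 - h ^+ 2) * u).
  have q1 : 4 * (A * ((1 + h) / 2)) * (B * ((1 - h) / 2)) * u
            = A * B * (1 - h ^+ 2) * u by field.
  have q2 : 4 * (A * ((1 - h) / 2)) * (B * ((1 + h) / 2)) * u
            = A * B * (1 - h ^+ 2) * u by field.
  rewrite /D2 /overlap_defect q1 q2 => H; apply: le_trans (H _ _ _ _ _) _.
  - by rewrite addr_ge0// mulr_ge0.
  - by rewrite addr_ge0// mulr_ge0.
  - by rewrite !mulr_ge0// subr_ge0.
  - apply: (@le_trans _ _ (A * B * (1 - h ^+ 2))).
      by rewrite ler_piMr// mulr_ge0// subr_ge0.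
    have := sqr_ge0 (A * ((1 + h) / 2) - B * ((1 - h) / 2)); nra.
  - apply: (@le_trans _ _ (A * B * (1 - h ^+ 2))).
      by rewrite ler_piMr// mulr_ge0// subr_ge0.
    have := sqr_ge0 (A * ((1 - h) / 2) - B * ((1 + h) / 2)); nra.
  - by apply: ler_wsqrtr; rewrite le_eqVlt; apply/orP; left; apply/eqP; field.
apply: (@le_trans _ _ ((1 - w) * overlap_defect u A B
    + w * overlap_defect (u * (1 - h ^+ 2)) A B)).
  by rewrite lerD2l ler_wpM2l.
have uhAB : 0 <= A * B * (u * (1 - h ^+ 2)) <= A * B.
  rewrite mulr_ge0 ?mulr_ge0 ?subr_ge0//= ler_piMr// mulr_ile1 ?subr_ge0//.
  by have := sqr_ge0 h; lra.
have sq := sqr_ge0 (A - B).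
(* The two locations are merged by concavity of the square root: the average of [u] and
   [u * (1 - h ^+ 2)] with weights [1 - w] and [w] is [u * (1 - w * h ^+ 2)]. *)
apply: le_trans (sqrt_concave _ _ _ w01 _ _) _.
- nra.
- nra.
- by apply: ler_wsqrtr; rewrite le_eqVlt; apply/orP; left; apply/eqP; ring.
Qed.

(** * Expectation over an atomic sample and the test of one sign *)

(* [mu i] is the mass of [x i] and [e i] the conditional probability of the
   label [true]. *)
Definition atomsum {R : realType} {X : Type} (m : nat) (mu e : nat -> R)
    (x : nat -> X) (f : X * bool -> R) : R :=
  \sum_(i < m) mu i * (e i * f (x i, true) + (1 - e i) * f (x i, false)).

(** Follows the recursion of [sampleE], with finite sums in place of integrals, so that the two can
    be compared by induction on [n]. *)
Fixpoint atomE {R : realType} {X : Type} (m : nat) (mu e : nat -> R)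
    (x : nat -> X) (n : nat) : (n.-tuple (X * bool) -> R) -> R :=
  match n return (n.-tuple (X * bool) -> R) -> R with
  | 0 => fun g => g [tuple]
  | n'.+1 => fun g => atomsum m mu e x
               (fun z => atomE m mu e x n' (fun t => g (cons_tuple z t)))
  end.

Lemma atomE_sum {R : realType} {X : Type} m (mu e : nat -> R) (x : nat -> X) n
    (k : nat) (g : 'I_k -> n.-tuple (X * bool) -> R) :
  atomE m mu e x n (fun t => \sum_(j < k) g j t)
  = \sum_(j < k) atomE m mu e x n (g j).
Proof.
elim: n g => [//|n IH] g /=.
rewrite /atomsum exchange_big /=; apply: eq_bigr => i _.
by rewrite !IH -mulr_sumr big_split/= -!mulr_sumr.
Qed.

Lemma atomEZ {R : realType} {X : Type} m (mu e : nat -> R) (x : nat -> X) n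
    (c : R) (g : n.-tuple (X * bool) -> R) :
  atomE m mu e x n (fun t => c * g t) = c * atomE m mu e x n g.
Proof.
elim: n g => [//|n IH] g /=.
by rewrite /atomsum mulr_sumr; apply: eq_bigr => i _; rewrite !IH; ring.
Qed.

Lemma atomE_ge0 {R : realType} {X : Type} m (mu e : nat -> R) (x : nat -> X) n
    (g : n.-tuple (X * bool) -> R) :
  (forall i, 0 <= mu i) -> (forall i, 0 <= e i <= 1) -> (forall t, 0 <= g t) ->
  0 <= atomE m mu e x n g.
Proof.
move=> mu0 e01; elim: n g => [|n IH] g g0 //=; apply: sumr_ge0 => i _.
have /andP[e0 e1] := e01 i.
by rewrite mulr_ge0// addr_ge0// mulr_ge0 ?subr_ge0// IH.
Qed.

(* The two laws differ only in the label of [x j]; [g] and [g'] are the losses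
   of one procedure under the two laws. *)
Lemma two_point_bound {R : realType} {X : Type} m (mu e e' : nat -> R)
    (x : nat -> X) (w h : R) (j : 'I_m) :
  (forall i, 0 <= mu i) -> (forall i, 0 <= e i <= 1) ->
  (forall i, 0 <= e' i <= 1) -> \sum_(i < m) mu i = 1 -> mu j = w ->
  0 <= h <= 1 -> (forall i : 'I_m, i != j -> e i = e' i) ->
  e j = (1 + h) / 2 -> e' j = (1 - h) / 2 ->
  forall n (g g' : n.-tuple (X * bool) -> R) (A B : R),
  (forall t, 0 <= g t) -> (forall t, 0 <= g' t) ->
  (forall t, 2 <= g t + g' t) -> 0 <= A -> 0 <= B ->
  A + B - overlap_defect ((1 - w * h ^+ 2) ^+ n) A B
  <= A * atomE m mu e x n g + B * atomE m mu e' x n g'.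
Proof.
move=> mu0 e01 e'01 mu1 muj h01 ee' ej e'j.
have w01 : 0 <= w <= 1.
  rewrite -muj mu0 /= -mu1 (bigD1 j)//= lerDl; exact: sumr_ge0.
have /andP[w0 w1] := w01; have /andP[h0 h1] := h01.
have sumD (f : 'I_m -> R) : \sum_(i < m | i != j) f i = \sum_(i < m) f i - f j.
  by rewrite [in RHS](bigD1 j)//= addrAC subrr add0r.
elim=> [|n IH] g g' A B g0 g'0 gg' A0 B0 /=.
  rewrite /overlap_defect expr0 mulr1.
  have -> : (A + B) ^+ 2 - 4 * A * B = (A - B) ^+ 2 by ring.
  rewrite sqrtr_sqr; have := gg' [tuple]; have := g0 [tuple]; have := g'0 [tuple].
  set a := g _; set b := g' _ => b0 a0 ab.
  (* Without observations, [a + b >= 2] gives [A * a + B * b >= 2 * min(A, B)], and this minimum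
     doubled is [A + B - |A - B|]. *)
  have [AB|BA] := leP B A.
    rewrite ger0_norm ?subr_ge0//.
    have := mulr_ge0 (_ : 0 <= A - B) a0; have := mulr_ge0 B0 (_ : 0 <= a + b - 2).
    by rewrite !subr_ge0 => /(_ ab) ? /(_ AB) ?; nra.
  rewrite ltr0_norm ?subr_lt0//.
  have := mulr_ge0 (_ : 0 <= B - A) b0; have := mulr_ge0 A0 (_ : 0 <= a + b - 2).
  by rewrite !subr_ge0 => /(_ ab) ? /(_ (ltW BA)) ?; nra.
set u := (1 - w * h ^+ 2) ^+ n.
have u01 : 0 <= u <= 1.
  have wh : 0 <= w * h ^+ 2 <= 1.
    by rewrite mulr_ge0 ?sqr_ge0//= mulr_ile1 ?sqr_ge0// expr_le1.
  by rewrite exprn_ge0 ?exprn_ile1//; lra.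
pose W a b : R := a + b - overlap_defect u a b.
(* Revealing the first observation multiplies [A] and [B] by its probabilities under the two laws.
   The induction hypothesis, which holds for all nonnegative weights, then handles the remaining
   observations. *)
have key (i : 'I_m) :
    W (A * (mu i * e i)) (B * (mu i * e' i))
    + W (A * (mu i * (1 - e i))) (B * (mu i * (1 - e' i)))
    <= A * (mu i * (e i * atomE m mu e x n (fun t => g (cons_tuple (x i, true) t))
           + (1 - e i) * atomE m mu e x n (fun t => g (cons_tuple (x i, false) t))))
     + B * (mu i * (e' i * atomE m mu e' x n (fun t => g' (cons_tuple (x i, true) t))
           + (1 - e' i) * atomE m mu e' x n (fun t => g' (cons_tuple (x i, false) t)))).
  have /andP[a0 a1] := e01 i; have /andP[b0 b1] := e'01 i.
  have H y a b : 0 <= a -> 0 <= b ->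
     W a b <= a * atomE m mu e x n (fun t => g (cons_tuple y t))
              + b * atomE m mu e' x n (fun t => g' (cons_tuple y t)).
    by move=> ha hb; apply: IH.
  have e1 := H (x i, true) (A * (mu i * e i)) (B * (mu i * e' i)).
  have e2 := H (x i, false) (A * (mu i * (1 - e i))) (B * (mu i * (1 - e' i))).
  apply: le_trans (lerD (e1 _ _) (e2 _ _)) _; try by rewrite !mulr_ge0// subr_ge0.
  by rewrite le_eqVlt; apply/orP; left; apply/eqP; ring.
rewrite /atomsum !mulr_sumr -big_split /=.
apply: le_trans (ler_sum _ (fun i _ => key i)).
(* At the other points the laws agree, so both weights are scaled alike and homogeneity pulls the
   mass out. *)
have common (i : 'I_m) : i != j ->
    W (A * (mu i * e i)) (B * (mu i * e' i))
    + W (A * (mu i * (1 - e i))) (B * (mu i * (1 - e' i))) = mu i * W A B.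
  move=> ij; rewrite -ee'//; have /andP[a0 a1] := e01 i.
  rewrite /W !overlap_defectZ ?mulr_ge0 ?subr_ge0//; ring.
rewrite (bigD1 j)//= (eq_bigr _ common) sumD -mulr_suml mu1 muj ej e'j.
rewrite (_ : 1 - (1 + h) / 2 = (1 - h) / 2); last by field.
rewrite (_ : 1 - (1 - h) / 2 = (1 + h) / 2); last by field.
have := overlap_defect_step u w h A B u01 w01 h01 A0 B0.
rewrite (exprSr _ n) -/u /W; lra.
Qed.

(** Take [A = B = 1] in the previous bound. Bernoulli's inequality gives [u >= 5/9], so the defect,
    the root of [4 - 4 u], is at most [4/3], and [2 - 4/3 = 2/3]. *)
Lemma two_point_third {R : realType} {X : Type} m (mu e e' : nat -> R)
    (x : nat -> X) (w h : R) (j : 'I_m) :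
  (forall i, 0 <= mu i) -> (forall i, 0 <= e i <= 1) ->
  (forall i, 0 <= e' i <= 1) -> \sum_(i < m) mu i = 1 -> mu j = w ->
  0 <= h <= 1 -> (forall i : 'I_m, i != j -> e i = e' i) ->
  e j = (1 + h) / 2 -> e' j = (1 - h) / 2 ->
  forall n (g g' : n.-tuple (X * bool) -> R), n%:R * (w * h ^+ 2) <= 4 / 9 ->
  (forall t, 0 <= g t) -> (forall t, 0 <= g' t) ->
  (forall t, 2 <= g t + g' t) ->
  2 / 3 <= atomE m mu e x n g + atomE m mu e' x n g'.
Proof.
move=> mu0 e01 e'01 mu1 muj h01 ee' ej e'j n g g' nwh g0 g'0 gg'.
have := two_point_bound m mu e e' x w h j mu0 e01 e'01 mu1 muj h01 ee' ej e'j
  n g g' 1 1 g0 g'0 gg' ler01 ler01.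
rewrite !mul1r; apply: le_trans.
have w01 : 0 <= w <= 1.
  rewrite -muj mu0 /= -mu1 (bigD1 j)//= lerDl; exact: sumr_ge0.
have /andP[w0 w1] := w01; have /andP[h0 h1] := h01.
have wh : 0 <= w * h ^+ 2 <= 1.
  by rewrite mulr_ge0 ?sqr_ge0//= mulr_ile1 ?sqr_ge0// expr_le1.
have bern : 1 - n%:R * (w * h ^+ 2) <= (1 - w * h ^+ 2) ^+ n.
  move: wh; set v := w * h ^+ 2 => /andP[v0 v1] {nwh g g' g0 g'0 gg'}.
  elim: n => [|n IH]; first by rewrite mul0r subr0 expr0.
  rewrite exprS -natr1.
  have := ler_wpM2l (_ : 0 <= 1 - v) IH; rewrite subr_ge0 => /(_ v1).
  apply: le_trans; have := mulr_ge0 (ler0n R n) (sqr_ge0 v); nra.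
suff : overlap_defect ((1 - w * h ^+ 2) ^+ n) 1 1 <= 4 / 3 by lra.
have -> : (4 / 3 : R) = Num.sqrt ((4 / 3) ^+ 2).
  by rewrite sqrtr_sqr ger0_norm//; lra.
by apply: ler_wsqrtr; move: bern; set v := _ ^+ n; lra.
Qed.

(** * Cube laws and averaging over sign patterns *)

Definition cube_mass {R : realType} (N : nat) (w : R) (i : nat) : R :=
  if (i < N)%N then w else 1 - N%:R * w.

(* [b i = true] means that the Bayes rule is [-1] at [x i]. *)
Definition cube_eta {R : realType} (N : nat) (h : R) (b : nat -> bool)
    (i : nat) : R :=
  if (i < N)%N then (if b i then (1 - h) / 2 else (1 + h) / 2) else 1.

(** Opposite convention to [lab]: the bit [false] stands for the value 1, which is also the value of
    the rules off the chosen points. *)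
Definition sgb {R : realType} (b : bool) : R := if b then -1 else 1.

Lemma sum_cube_mass {R : realType} (N : nat) (w : R) (F : nat -> R) :
  \sum_(i < N.+1) cube_mass N w i * F i
  = w * (\sum_(i < N) F i) + (1 - N%:R * w) * F N.
Proof.
rewrite big_ord_recr /= {2}/cube_mass ltnn mulr_sumr; congr (_ + _).
by apply: eq_bigr => i _; rewrite /cube_mass ltn_ord.
Qed.

Lemma cube_mass_ge0 {R : realType} (N : nat) (w : R) i :
  0 <= w -> N%:R * w <= 1 -> 0 <= cube_mass N w i.
Proof. by move=> w0 Nw; rewrite /cube_mass; case: ifP => // _; rewrite subr_ge0. Qed.

Lemma sum_cube_mass1 {R : realType} (N : nat) (w : R) :
  \sum_(i < N.+1) cube_mass N w i = 1.
Proof.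
have := sum_cube_mass N w (fun=> 1); under eq_bigr do rewrite mulr1.
by move=> ->; rewrite sumr_const card_ord; lra.
Qed.

Lemma cube_eta01 {R : realType} (N : nat) (h : R) b i :
  0 <= h <= 1 -> 0 <= cube_eta N h b i <= 1.
Proof. by move=> /andP[h0 h1]; rewrite /cube_eta; case: (i < N)%N; case: (b i); lra. Qed.

(** For each [j], the patterns are paired by flipping the [j]-th sign. A pair has total loss at
    least [2/3] at [x j], so the average over all patterns is at least [1/3]. Summing over [j] with
    weights [w * h] bounds the average, and some pattern does at least as badly; it depends on
    [f]. *)
Lemma assouad {R : realType} {X : Type} (N n : nat) (w h : R) (x : nat -> X)
    (f : X -> n.-tuple (X * bool) -> R) :
  0 <= w -> N%:R * w <= 1 -> 0 <= h <= 1 -> n%:R * (w * h ^+ 2) <= 4 / 9 ->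
  exists b : nat -> bool,
    N%:R * w * h / 3 <=
    atomE N.+1 (cube_mass N w) (cube_eta N h b) x n
      (fun t => \sum_(j < N) w * h * Num.max (1 - sgb (b j) * f (x j) t) 0).
Proof.
move=> w0 Nw h01 nwh; have /andP[h0 h1] := h01.
(* Patterns form a finite type, over which one can average; [ext] pads them with [false]. *)
pose ext (s : {ffun 'I_N -> bool}) (i : nat) : bool :=
  if insub i is Some j then s j else false.
have extE (s : {ffun 'I_N -> bool}) (j : 'I_N) : ext s j = s j by rewrite /ext valK.
pose E s g := atomE N.+1 (cube_mass N w) (cube_eta N h (ext s)) x n g.
pose Q (j : 'I_N) (s : {ffun 'I_N -> bool}) := E s (fun t => Num.max (1 - sgb (s j) * f (x j) t) 0).
pose L (s : {ffun 'I_N -> bool}) := \sum_(j < N) w * h * Q j s.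
pose flip (j : 'I_N) (s : {ffun 'I_N -> bool}) : {ffun 'I_N -> bool} :=
  [ffun i => if i == j then ~~ s i else s i].
have flipK j : involutive (flip j).
  by move=> s; apply/ffunP => i; rewrite !ffunE; case: eqP => // _; rewrite negbK.
have pairQ (j : 'I_N) (s : {ffun 'I_N -> bool}) : s j = false -> 2 / 3 <= Q j s + Q j (flip j s).
  move=> sj; have fsj : flip j s j = true by rewrite ffunE eqxx sj.
  apply: (two_point_third N.+1 (cube_mass N w) (cube_eta N h (ext s))
    (cube_eta N h (ext (flip j s))) x w h (widen_ord (leqnSn N) j)) => //.
  - by move=> i; exact: cube_mass_ge0.
  - by move=> i; exact: cube_eta01.
  - by move=> i; exact: cube_eta01.
  - exact: sum_cube_mass1.
  - by rewrite /cube_mass /= ltn_ord.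
  - move=> i ij; rewrite /cube_eta; case: ifPn => // iN.
    have -> : ext (flip j s) i = ext s i; last by [].
    rewrite (extE _ (Ordinal iN)) (extE s (Ordinal iN)) ffunE ifN//.
  - by rewrite /cube_eta /= ltn_ord extE sj.
  - by rewrite /cube_eta /= ltn_ord extE fsj.
  - by move=> t; rewrite le_max lexx orbT.
  - by move=> t; rewrite le_max lexx orbT.
  (* For every real prediction [v], the hinge losses [max(1 - v, 0)] and [max(1 + v, 0)] against
     opposite signs sum to at least 2. *)
  - move=> t; rewrite sj fsj /sgb.
    set v := f _ _; have H1 : 1 - 1 * v <= Num.max (1 - 1 * v) 0.
      by rewrite le_max lexx.
    have H2 : 1 - -1 * v <= Num.max (1 - -1 * v) 0 by rewrite le_max lexx.
    by lra.
have pairQ' (j : 'I_N) (s : {ffun 'I_N -> bool}) : 2 / 3 <= Q j s + Q j (flip j s).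
  case sj : (s j); last exact: pairQ.
  have := pairQ j (flip j s); rewrite flipK addrC; apply.
  by rewrite ffunE eqxx sj.
have sumQ j : #|{ffun 'I_N -> bool}|%:R / 3 <= \sum_s Q j s.
  have : \sum_(s : {ffun 'I_N -> bool}) 2 / 3 <= \sum_s (Q j s + Q j (flip j s)).
    by apply: ler_sum => s _.
  rewrite big_split/= sumr_const -(mulr_natl _ #|_|).
  have -> : \sum_s Q j (flip j s) = \sum_s Q j s.
    by rewrite [RHS](reindex_inj (inv_inj (flipK j))).
  by lra.
have sumL : #|{ffun 'I_N -> bool}|%:R * (N%:R * w * h / 3) <= \sum_s L s.
  rewrite /L exchange_big /=.
  apply: (@le_trans _ _ (\sum_(j < N) w * h * (#|{ffun 'I_N -> bool}|%:R / 3))).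
    by rewrite sumr_const card_ord -(mulr_natl (w * h * _)); lra.
  by apply: ler_sum => j _; rewrite -mulr_sumr ler_wpM2l// mulr_ge0.
have [s Ls] : exists s, N%:R * w * h / 3 <= L s.
  apply/not_existsP => Hs.
  have : \sum_s L s < \sum_(s : {ffun 'I_N -> bool}) N%:R * w * h / 3.
    apply: ltr_sum => [|s _].
      by apply/hasP; exists [ffun=> false]; rewrite ?mem_index_enum.
    by rewrite ltNge; apply/negP/Hs.
  rewrite sumr_const -(mulr_natl _ #|_|); lra.
exists (ext s); apply: le_trans Ls _.
rewrite atomE_sum /L le_eqVlt; apply/orP; left; apply/eqP.
by apply: eq_bigr => j _; rewrite atomEZ /Q /E extE.
Qed.

(** * Atomic laws *)

(** For injective [x], it interpolates [v] at the first [m] points and vanishes elsewhere. The sum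
    of indicators makes it measurable as soon as singletons are. *)
Definition ptfun {R : realType} {X : Type} (m : nat) (v : nat -> R)
    (x : nat -> X) (y : X) : R := \sum_(i < m) v i * \1_[set x i] y.

Lemma ptfun_at {R : realType} {X : Type} m (v : nat -> R) (x : nat -> X) i :
  injective x -> (i < m)%N -> ptfun m v x (x i) = v i.
Proof.
move=> xinj im; rewrite /ptfun (bigD1 (Ordinal im))//= big1 ?addr0.
  by rewrite indicE mem_set// mulr1.
move=> j ji; rewrite indicE memNset ?mulr0//= => /xinj ij.
by move/eqP: ji; apply; apply/val_inj.
Qed.

Lemma ptfun_out {R : realType} {X : Type} m (v : nat -> R) (x : nat -> X) y :
  (forall i, (i < m)%N -> y <> x i) -> ptfun m v x y = 0.
Proof.
move=> yx; rewrite /ptfun big1// => i _.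
by rewrite indicE memNset ?mulr0//=; exact: yx.
Qed.

Lemma ptfun_cases {R : realType} {X : Type} m (v : nat -> R) (x : nat -> X) y :
  injective x ->
  (exists2 i, (i < m)%N & y = x i /\ ptfun m v x y = v i)
  \/ ((forall i, (i < m)%N -> y <> x i) /\ ptfun m v x y = 0).
Proof.
move=> xinj; have [[i im ->]|no] := pselect (exists2 i, (i < m)%N & y = x i).
  by left; exists i => //; rewrite ptfun_at.
have yx i : (i < m)%N -> y <> x i by move=> im yxi; apply: no; exists i.
by right; rewrite ptfun_out.
Qed.

Lemma measurable_ptfun {R : realType} {d} {X : measurableType d} m
    (v : nat -> R) (x : nat -> X) :
  (forall y : X, measurable [set y]) -> measurable_fun setT (ptfun m v x).
Proof.
move=> mX; apply: measurable_sum => i; exact: measurable_funM.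
Qed.

Lemma measurable_bool_fun {d} {Y : measurableType d} (f : bool -> Y) :
  measurable_fun setT f.
Proof. by move=> _ A _. Qed.

Lemma measurable_fun_label {R : realType} {d} {X : measurableType d}
    (g : X * bool -> R) :
  (forall b, measurable_fun setT (fun y => g (y, b))) -> measurable_fun setT g.
Proof.
move=> mg.
have -> : g = (fun z => (z.2 : nat)%:R * g (z.1, true)
                        + (~~ z.2 : nat)%:R * g (z.1, false)).
  by apply/funext => -[y []] /=; ring.
have mlab (f : bool -> R) : measurable_fun setT (fun z : X * bool => f z.2).
  exact: (measurableT_comp (measurable_bool_fun f) measurable_snd).
apply: measurable_funD; apply: measurable_funM.
- exact: (mlab (fun b => (b : nat)%:R)).
- exact: (measurableT_comp (mg true) measurable_fst).
- exact: (mlab (fun b => (~~ b : nat)%:R)).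
- exact: (measurableT_comp (mg false) measurable_fst).
Qed.

(** Scaling a measure takes a nonnegative factor; the absolute values provide one unconditionally
    and disappear once the masses are nonnegative and [e] lies in [[0,1]]. *)
Definition atom_msr {R : realType} {d} {X : measurableType d} (m : nat)
    (mu e : nat -> R) (x : nat -> X) :=
  msum (fun i => measure_add
    (mscale (NngNum (normr_ge0 (mu i * e i))) (\d_(x i, true)))
    (mscale (NngNum (normr_ge0 (mu i * (1 - e i)))) (\d_(x i, false)))) m.

HB.instance Definition _ (R : realType) d (X : measurableType d) m mu e x :=
  Measure.on (@atom_msr R d X m mu e x).

Lemma integral_atom_msr {R : realType} {d} {X : measurableType d} m
    (mu e : nat -> R) (x : nat -> X) (f : X * bool -> R) :
  (forall i, 0 <= mu i) -> (forall i, 0 <= e i <= 1) ->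
  measurable_fun setT f -> (forall z, 0 <= f z) ->
  (\int[atom_msr m mu e x]_z (f z)%:E = (atomsum m mu e x f)%:E)%E.
Proof.
move=> mu0 e01 mf f0.
have mF : measurable_fun setT (EFin \o f) by exact/measurable_EFinP.
rewrite ge0_integral_measure_sum//; last by move=> z _; rewrite lee_fin.
rewrite /atomsum -sumEFin; apply: eq_bigr => i _.
have /andP[e0 e1] := e01 i.
rewrite ge0_integral_measure_add//; last by move=> z _; rewrite lee_fin.
rewrite !ge0_integral_mscale//; try by move=> z _; rewrite lee_fin.
rewrite !integral_dirac// !diracT !mul1e /= !ger0_norm ?mulr_ge0 ?subr_ge0//.
by rewrite -!EFinM -EFinD; congr EFin; ring.
Qed.

Section AtomicProbability.
Context {R : realType} {d : measure_display} {X : measurableType d}.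
Variables (m : nat) (mu e : nat -> R) (x : nat -> X).
Hypothesis mu0 : forall i, 0 <= mu i.
Hypothesis e01 : forall i, 0 <= e i <= 1.
Hypothesis mu1 : \sum_(i < m) mu i = 1.

Lemma atom_msr_setT : atom_msr m mu e x setT = 1%E.
Proof.
rewrite -[LHS]mul1e -integral_cst//.
rewrite (integral_atom_msr m mu e x (cst 1) mu0 e01)//.
transitivity (\sum_(i < m) mu i)%:E; last by rewrite mu1.
by congr EFin; apply: eq_bigr => i _ /=; ring.
Qed.

HB.instance Definition _ :=
  @Measure_isProbability.Build _ _ R (atom_msr m mu e x) atom_msr_setT.

Definition atom_prob : probability (X * bool)%type R := atom_msr m mu e x.

End AtomicProbability.

(** The later sections know the law only through this formula for integrals. *)
Lemma atom_probability {R : realType} {d} {X : measurableType d} m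
    (mu e : nat -> R) (x : nat -> X) :
  (forall i, 0 <= mu i) -> (forall i, 0 <= e i <= 1) ->
  \sum_(i < m) mu i = 1 ->
  exists P : probability (X * bool)%type R,
    forall f : X * bool -> R, measurable_fun setT f -> (forall z, 0 <= f z) ->
    (\int[P]_z (f z)%:E = (atomsum m mu e x f)%:E)%E.
Proof.
move=> mu0 e01 mu1; exists (atom_prob m mu e x mu0 e01 mu1) => f mf f0.
exact: integral_atom_msr.
Qed.

(** * Comparing integrals with atomic sums *)

(** The integral of a nonnegative function is a supremum over the simple functions below it, and a
    larger function has more of them. This is suited to the nested integrands of [sampleE]. *)
Lemma le_integral_nonmeasurable {R : realType} {d} {T : measurableType d}
    (P : {measure set T -> \bar R}) (f g : T -> \bar R) :
  (forall z, 0 <= f z)%E -> (forall z, f z <= g z)%E ->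
  (\int[P]_z f z <= \int[P]_z g z)%E.
Proof.
move=> f0 fg; rewrite !ge0_integralTE//; last first.
  by move=> z; exact: le_trans (f0 z) (fg z).
apply: le_ereal_sup => _ [h hf <-]; exists h => //= z.
exact: le_trans (hf z) (fg z).
Qed.

Section AtomicLaw.
Context {R : realType} {d : measure_display} {X : measurableType d}.
Variables (m : nat) (mu e : nat -> R) (x : nat -> X).
Variable P : probability (X * bool)%type R.
Hypothesis mX : forall y : X, measurable [set y].
Hypothesis xinj : injective x.
Hypothesis mu0 : forall i, 0 <= mu i.
Hypothesis e01 : forall i, 0 <= e i <= 1.
Hypothesis PE : forall f : X * bool -> R,
  measurable_fun setT f -> (forall z, 0 <= f z) ->
  (\int[P]_z (f z)%:E = (atomsum m mu e x f)%:E)%E.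

(** Replace [g] by the function [g'] that agrees with it on the atoms and is 0 elsewhere. It is
    measurable, lies below [g], and has the same atomic sum, which is its integral. *)
Lemma atomsum_le_integral (g : X * bool -> R) (G : X * bool -> \bar R) :
  (forall z, 0 <= g z) -> (forall z, (g z)%:E <= G z)%E ->
  ((atomsum m mu e x g)%:E <= \int[P]_z G z)%E.
Proof.
move=> g0 gG.
pose g' (z : X * bool) := ptfun m (fun i => g (x i, z.2)) x z.1.
have g'_le z : 0 <= g' z <= g z.
  case: z => y b; rewrite /g' /=.
  have [[i im [-> ->]]|[_ ->]] := ptfun_cases m (fun i => g (x i, b)) x y xinj.
    by rewrite g0 lexx.
  by rewrite lexx g0.
have -> : atomsum m mu e x g = atomsum m mu e x g'.
  by apply: eq_bigr => i _; rewrite /g' /= !ptfun_at.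
rewrite -PE; first last.
- by move=> z; have /andP[] := g'_le z.
- apply: measurable_fun_label => b.
  exact: (measurable_ptfun m (fun i => g (x i, b)) x mX).
apply: le_integral_nonmeasurable => z; have /andP[z0 zg] := g'_le z.
  by rewrite lee_fin.
by apply: le_trans (gG z); rewrite lee_fin.
Qed.

Lemma atomE_le_sampleE n (g : n.-tuple (X * bool) -> R)
    (G : n.-tuple (X * bool) -> \bar R) :
  (forall t, 0 <= g t) -> (forall t, (g t)%:E <= G t)%E ->
  ((atomE m mu e x n g)%:E <= sampleE P G)%E.
Proof.
elim: n g G => [|n IH] g G g0 gG /=; first exact: gG.
apply: atomsum_le_integral => [z|z]; last exact: IH.
by apply: atomE_ge0.
Qed.

Lemma hinge_atom (f : X -> R) : measurable_fun setT f ->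
  hinge P f = (atomsum m mu e x (fun z => Num.max (1 - lab z.2 * f z.1) 0))%:E.
Proof.
move=> mf; rewrite /hinge PE//; last by move=> z; rewrite le_max lexx orbT.
apply: measurable_fun_label => b /=; apply: measurable_maxr => //.
by apply: measurable_funB => //; exact: measurable_funM.
Qed.

Lemma hinge_atom_ge (f : X -> R) :
  ((atomsum m mu e x (fun z => Num.max (1 - lab z.2 * f z.1) 0))%:E
   <= hinge P f)%E.
Proof. 
by apply: atomsum_le_integral => [z|z]; rewrite ?lexx// le_max lexx orbT.
Qed.

Lemma is_eta_atom : is_eta P (ptfun m e x).
Proof.
split; first exact: measurable_ptfun.
split.
  move=> y; have [[i im [-> ->]]|[_ ->]] := ptfun_cases m e x y xinj => //.
  by rewrite lexx ler01.
move=> A mA.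
have mAt : measurable (A `*` [set true]) by exact: measurableX.
rewrite -[LHS](_ : (\int[P]_z (\1_(A `*` [set true]) z)%:E)%E = _); last first.
  by rewrite integral_indic// setIT.
rewrite !PE//.
- congr EFin; apply: eq_bigr => i _ /=.
  rewrite ptfun_at// !indicE; congr (_ * _).
  rewrite [in X in _ * X + _](_ : ((x i, true) \in _) = (x i \in A)); last first.
    by apply/idP/idP; rewrite !inE//= => -[].
  rewrite [in X in _ + _ * X = _](_ : ((x i, false) \in _) = false); last first.
    by apply/negbTE; rewrite notin_setE/= => -[].
  by rewrite (_ : (false : nat)%:R = 0 :> R)//; ring.
- apply: measurable_fun_label => b; apply: measurable_funM.
    exact: measurable_indic.
  exact: measurable_ptfun.
- move=> z; rewrite mulr_ge0// /ptfun sumr_ge0// => i _.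
  by rewrite mulr_ge0//; have /andP[] := e01 i.
Qed.

End AtomicLaw.

(** * The margin inequality *)

Lemma powR_chord {R : realType} (k p l : R) : 1 <= k -> 0 <= p -> 0 <= l <= 1 ->
  (l + (1 - l) * p) `^ k <= l + (1 - l) * p `^ k.
Proof.
move=> k1 p0 /andP[l0 l1].
suff : (l * 1 + (1 - l) * p) `^ k <= l * 1 `^ k + (1 - l) * p `^ k.
  by rewrite powR1 !mulr1.
by apply: (convex_powR k1 (Itv01 l0 l1)); rewrite inE /= in_itv /= ?ler01 ?p0.
Qed.

Lemma powR_le_id {R : realType} (a k : R) : 0 <= a <= 1 -> 1 <= k -> a `^ k <= a.
Proof.
move=> /andP[]; rewrite le_eqVlt => /orP[/eqP <- _ k1|a0 a1].
  by rewrite powR0// gt_eqF//; lra.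
by apply: ge1r_powR; rewrite a0.
Qed.

Definition mah_const {R : realType} (k : R) : R :=
  (3 / 2 * 2 `^ (k - 1)) `^ k^-1.

Lemma mah_const_gt0 {R : realType} (k : R) : 0 < mah_const k.
Proof. by apply: powR_gt0; rewrite mulr_gt0 ?powR_gt0//; lra. Qed.

Lemma mah_constE {R : realType} (k : R) : 1 <= k ->
  mah_const k `^ k = 3 / 2 * 2 `^ (k - 1).
Proof.
move=> k1; rewrite /mah_const -powRrM mulVf ?powRr1//.
by rewrite gt_eqF//; lra.
Qed.

(* With [t = 2 p a] and [u = 2 (1 - p) b], the left side is convex in [(a, b)]
   on the unit square and the bound is linear, so only corners matter. *)
Lemma mah_ineq {R : realType} (k p h t u : R) : 1 <= k -> 0 <= p <= 3^-1 ->
  0 <= h -> p `^ k <= 3 / 2 * (p * h) -> 0 <= t <= 2 * p ->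
  0 <= u <= 2 * (1 - p) ->
  t + u <= mah_const k * (h * t + u) `^ k^-1.
Proof.
move=> k1 /andP[p0 p3] h0 pk /andP[t0 t1] /andP[u0 u1].
have k0 : 0 < k by lra.
have ht0 : 0 <= h * t by rewrite mulr_ge0.
have p1 : 0 < 1 - p by lra.
suff key : ((t + u) / 2) `^ k <= 3 / 2 * ((h * t + u) / 2).
  rewrite /mah_const -powRM; last 2 first.
  - by rewrite mulr_ge0 ?powR_ge0//; lra.
  - by lra.
  have -> : t + u = ((t + u) `^ k) `^ k^-1.
    by rewrite -powRrM mulfV ?gt_eqF// powRr1//; lra.
  apply: ge0_ler_powR; rewrite ?nnegrE ?invr_ge0 ?powR_ge0//; first by lra.
    by rewrite !mulr_ge0 ?powR_ge0//; lra.
  have -> : t + u = 2 * ((t + u) / 2) by field.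
  rewrite powRM//; last by lra.
  have -> : (2 : R) `^ k = 2 `^ (k - 1) * 2.
    rewrite -[X in _ = _ * X](@powRr1 _ 2)// -powRD ?subrK//.
    by rewrite pnatr_eq0 implybT.
  have := ler_wpM2l (powR_ge0 2 (k - 1)) key; lra.
(* The comparison is that of [a] and [b]. If [a <= b], the average is at most [b = u / (2 (1 - p))],
   which is at most [(3/4) u] because [p <= 1/3]. *)
have [tu|ut] := leP (t * (1 - p)) (u * p).
  have S1 : (t + u) / 2 <= u / (2 * (1 - p)).
    by rewrite ler_pdivlMr; [nra|lra].
  have S01 : 0 <= (t + u) / 2 <= 1 by lra.
  apply: (@le_trans _ _ ((t + u) / 2)); first exact: powR_le_id.
  have : u / (2 * (1 - p)) <= 3 / 4 * u by rewrite ler_pdivrMr; [nra|lra].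
  by lra.
have p0' : 0 < p by rewrite lt_neqAle p0 andbT; apply/eqP => p00; nra.
have t0' : 0 < t by rewrite lt_neqAle t0 andbT; apply/eqP => t00; nra.
pose a := t / (2 * p); pose l := u * p / (t * (1 - p)).
have a01 : 0 <= a <= 1.
  by rewrite /a divr_ge0 ?ler_pdivrMr ?mul1r//; lra.
have l01 : 0 <= l <= 1.
  rewrite /l divr_ge0 ?mulr_ge0 ?(ltW p1)// ler_pdivrMr ?mulr_gt0// mul1r.
  exact: ltW.
have Sal : (t + u) / 2 = a * (l + (1 - l) * p).
  by rewrite /a /l; field; rewrite !gt_eqF.
have al : a * l <= 3 / 4 * u.
  have -> : a * l = u / (2 * (1 - p)) by rewrite /a /l; field; rewrite !gt_eqF.
  by rewrite ler_pdivrMr; [nra|lra].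
have apt : a * p = t / 2 by rewrite /a; field; rewrite gt_eqF.
have /andP[a0 a1] := a01; have /andP[l0 l1] := l01.
have y0 : 0 <= l + (1 - l) * p by rewrite addr_ge0// mulr_ge0// subr_ge0.
rewrite Sal powRM//.
have ak : a `^ k <= a by exact: powR_le_id.
apply: (@le_trans _ _ (a * (l + (1 - l) * p `^ k))).
  by rewrite ler_pM ?powR_ge0// powR_chord.
have : a * ((1 - l) * p `^ k) <= 3 / 4 * (h * t).
  apply: (@le_trans _ _ (a * (3 / 2 * (p * h)))); last by nra.
  rewrite ler_wpM2l//; apply: le_trans pk.
  by rewrite ler_piMl ?powR_ge0//; lra.
by rewrite mulrDr; lra.
Qed.

(** * Two numerical estimates *)

(** Start from [1 + 1/128 <= exp(1/128)] and square seven times, rounding down to short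
    fractions. *)
Lemma expR1_ge27 {R : realType} : 27 / 10 <= expR 1 :> R.
Proof.
have -> : (1 : R) = 128%:R * 128^-1 by rewrite divff ?pnatr_eq0.
rewrite expRM_natl.
have sq (y a b : R) (m : nat) : 0 <= a -> a <= y ^+ m -> b <= a ^+ 2 ->
    b <= y ^+ (m * 2).
  move=> a0 ay ba; apply: le_trans ba _.
  by rewrite exprM ler_pXn2r// nnegrE (le_trans a0 ay).
have e0 := @expR_ge1Dx R 128^-1.
set y := expR _ in e0 *.
have e1 : 583 / 574 <= y ^+ 2.
  by apply: (sq y (129 / 128) _ 1%N); rewrite ?expr1 ?expr2; lra.
have e2 : 10316 / 10000 <= y ^+ 4.
  by apply: sq e1 _; rewrite ?expr2; lra.
have e3 : 10641 / 10000 <= y ^+ 8.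
  by apply: sq e2 _; rewrite ?expr2; lra.
have e4 : 11323 / 10000 <= y ^+ 16.
  by apply: sq e3 _; rewrite ?expr2; lra.
have e5 : 12821 / 10000 <= y ^+ 32.
  by apply: sq e4 _; rewrite ?expr2; lra.
have e6 : 16437 / 10000 <= y ^+ 64.
  by apply: sq e5 _; rewrite ?expr2; lra.
by apply: sq e6 _; rewrite ?expr2; lra.
Qed.

(** This is [(5/8) log2 M <= N] for the integer part [N] of [log2 M]. The tight case is [M = 3],
    where [243 <= 256]; for [N >= 2] it follows from [M < 2 ^ (N + 1)] and [5 (N + 1) <= 8 N]. *)
Lemma leq_pow_trunc_log (M : nat) : (1 < M)%N ->
  (M ^ 5 <= 2 ^ (8 * trunc_log 2 M))%N.
Proof.
move=> M1; have /andP[_] := trunc_log_bounds (isT : 1 < 2)%N (ltnW M1).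
have : (0 < trunc_log 2 M)%N by rewrite trunc_log_gt0.
case: (trunc_log 2 M) => [//|[_ M4|N _ MN]].
  by move: M1 M4; case: M => [|[|[|[|]]]].
apply: (@leq_trans ((2 ^ N.+3) ^ 5)%N); first by rewrite leq_exp2r// ltnW.
by rewrite -expnM leq_exp2l//; lia.
Qed.

(** * Risks under the cube law *)

Section CubeLaw.
Context {R : realType} {d : measure_display} {X : measurableType d}.
Variables (N : nat) (w h : R) (b : nat -> bool) (x : nat -> X).
Variable P : probability (X * bool)%type R.
Hypothesis mX : forall y : X, measurable [set y].
Hypothesis xinj : injective x.
Hypothesis w0 : 0 <= w.
Hypothesis Nw : N%:R * w <= 1.
Hypothesis h0 : 0 < h.
Hypothesis h1 : h <= 1.
Let mu := cube_mass N w.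
Let e := cube_eta N h b.
Hypothesis PE : forall f : X * bool -> R,
  measurable_fun setT f -> (forall z, 0 <= f z) ->
  (\int[P]_z (f z)%:E = (atomsum N.+1 mu e x f)%:E)%E.

Let mu0 i : 0 <= mu i. Proof. exact: cube_mass_ge0. Qed.
Let e01 i : 0 <= e i <= 1. Proof. by apply: cube_eta01; rewrite ltW. Qed.

Definition cube_dist (f : X -> R) : R :=
  w * \sum_(j < N) `|f (x j) - sgb (b j)| + (1 - N%:R * w) * `|f (x N) - 1|.

(** The excess hinge risk of a function with values in [[-1,1]], where the hinge loss is affine.
    Only the factor [h] distinguishes it from [cube_dist]. *)
Definition cube_excess (f : X -> R) : R :=
  h * (w * \sum_(j < N) `|f (x j) - sgb (b j)|)
  + (1 - N%:R * w) * `|f (x N) - 1|.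

(** The least conditional hinge risk is [2 min(eta, 1 - eta) = 1 - h] at each of the [N] points and
    0 at [x N]. *)
Definition cube_hinge_star : R := N%:R * w * (1 - h).

Lemma cube_sum (F : nat -> R) :
  \sum_(i < N.+1) mu i * F i = w * (\sum_(i < N) F i) + (1 - N%:R * w) * F N.
Proof. exact: sum_cube_mass. Qed.

Let hloss (f : X -> R) (z : X * bool) : R := Num.max (1 - lab z.2 * f z.1) 0.

Lemma maxr0_ge (v : R) : v <= Num.max v 0 /\ 0 <= Num.max v 0.
Proof. by rewrite !le_max !lexx orbT. Qed.

(** Here [p] and [q] dominate the hinge losses of [v] against the signs 1 and -1, so [p + q >= 2]. A
    conditional risk is [(1 - h) / 2 * (p + q)] plus [h] times the loss against the Bayes sign. *)
Lemma cube_point_bound (v p q : R) : 1 - 1 * v <= p -> 1 - -1 * v <= q ->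
     (1 - h + h * q <= (1 - h) / 2 * p + (1 - (1 - h) / 2) * q)
  /\ (1 - h + h * p <= (1 + h) / 2 * p + (1 - (1 + h) / 2) * q).
Proof.
move=> vp vq; have pq : 0 <= p + q - 2 by lra.
have h1' : 0 <= 1 - h by rewrite subr_ge0.
by have := mulr_ge0 h1' pq; split; lra.
Qed.

Lemma cube_hinge_ge (f : X -> R) :
  cube_hinge_star + \sum_(j < N) w * h * Num.max (1 - sgb (b j) * f (x j)) 0
  <= atomsum N.+1 mu e x (hloss f).
Proof.
rewrite /atomsum.
rewrite (cube_sum (fun i => e i * hloss f (x i, true)
                            + (1 - e i) * hloss f (x i, false))).
apply: ler_wpDr.
  have /andP[? ?] := e01 N.
  rewrite mulr_ge0 ?subr_ge0// addr_ge0// mulr_ge0 ?subr_ge0//.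
    by have [] := maxr0_ge (1 - lab true * f (x N)).
  by have [] := maxr0_ge (1 - lab false * f (x N)).
rewrite -mulr_sumr -(mulrA w) /cube_hinge_star (mulrC _ w) -(mulrA w) -mulrDr.
apply: ler_wpM2l => //.
have -> : N%:R * (1 - h) = \sum_(j < N) (1 - h).
  by rewrite sumr_const card_ord mulr_natl.
rewrite mulr_sumr -big_split; apply: ler_sum => j _ /=.
rewrite /e /cube_eta ltn_ord /hloss /sgb /lab /=.
set v := f _; have [p1 _] := maxr0_ge (1 - 1 * v).
have [m1 _] := maxr0_ge (1 - -1 * v).
by have [? ?] := cube_point_bound _ _ _ p1 m1; case: (b j).
Qed.

Lemma normB_sgb (v : R) c : -1 <= v <= 1 -> `|v - sgb c| = 1 - sgb c * v.
Proof.
by case/andP=> v1 v2; case: c; rewrite /sgb; [rewrite ger0_norm|rewrite ler0_norm];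
  lra.
Qed.

Lemma cube_hinge_eq (f : X -> R) : unit_interval_fun f ->
  atomsum N.+1 mu e x (hloss f) = cube_hinge_star + cube_excess f.
Proof.
move=> f1; rewrite /atomsum.
rewrite (cube_sum (fun i => e i * hloss f (x i, true)
                            + (1 - e i) * hloss f (x i, false))).
have hl y c : hloss f (y, c) = 1 - lab c * f y.
  by rewrite /hloss /= max_l//; have := f1 y; rewrite /lab; case: c; lra.
have -> : \sum_(i < N) (e i * hloss f (x i, true)
                        + (1 - e i) * hloss f (x i, false))
    = N%:R * (1 - h) + h * \sum_(j < N) `|f (x j) - sgb (b j)|.
  have -> : N%:R * (1 - h) = \sum_(j < N) (1 - h).
    by rewrite sumr_const card_ord mulr_natl.
  rewrite mulr_sumr -big_split; apply: eq_bigr => j _ /=.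
  rewrite !hl normB_sgb// /e /cube_eta ltn_ord /lab /sgb.
  by case: (b j); field.
have := normB_sgb (f (x N)) false (f1 _); rewrite /sgb => fN.
rewrite !hl /cube_excess fN /cube_hinge_star /e /cube_eta ltnn /lab; ring.
Qed.

Lemma cube_excess_ge0 f : 0 <= cube_excess f.
Proof.
rewrite addr_ge0// ?mulr_ge0 ?subr_ge0 ?(ltW h0)// sumr_ge0//.
Qed.

Lemma cube_excess0 (f : X -> R) :
  (forall j, (j < N)%N -> f (x j) = sgb (b j)) -> f (x N) = 1 ->
  cube_excess f = 0.
Proof.
move=> fj fN; rewrite /cube_excess fN subrr normr0 mulr0 addr0 big1 ?mulr0//.
by move=> j _; rewrite fj// subrr normr0.
Qed.

Lemma cube_hinge_ge_star (f : X -> R) : (cube_hinge_star%:E <= hinge P f)%E.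
Proof.
apply: le_trans (hinge_atom_ge N.+1 mu e x P mX xinj PE f).
rewrite lee_fin; apply: le_trans (cube_hinge_ge f); rewrite lerDl sumr_ge0//.
by move=> j _; rewrite !mulr_ge0 ?(ltW h0)//; case: (maxr0_ge (1 - sgb (b j) * f (x j))).
Qed.

Lemma hinge_cubeE (f : X -> R) : measurable_fun setT f -> unit_interval_fun f ->
  hinge P f = (cube_hinge_star + cube_excess f)%:E.
Proof.
by move=> mf f1; rewrite (hinge_atom N.+1 mu e x P PE)// cube_hinge_eq.
Qed.

Lemma pm1_unit_interval (f : X -> R) : pm1_fun f -> unit_interval_fun f.
Proof. by move=> f1 y; case: (f1 y) => ->; lra. Qed.

(** A measurable rule with the Bayes values on the atoms; it attains both infima. In the theorem it
    is one of the rules. *)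
Variable fb : X -> R.
Hypothesis mfb : measurable_fun setT fb.
Hypothesis fb1 : pm1_fun fb.
Hypothesis fbj : forall j, (j < N)%N -> fb (x j) = sgb (b j).
Hypothesis fbN : fb (x N) = 1.

Lemma hinge_star_cube : hinge_star P = cube_hinge_star%:E.
Proof.
apply/eqP; rewrite eq_le; apply/andP; split.
  apply: ereal_inf_lbound; exists fb => //.
  by rewrite hinge_cubeE ?cube_excess0 ?addr0//; exact: pm1_unit_interval.
by apply: le_ereal_inf_tmp => _ [f _ <-]; exact: cube_hinge_ge_star.
Qed.

(** A rule with values 1 and -1 has hinge loss 0 or 2, twice its misclassification loss. *)
Lemma risk_cubeE (f : X -> R) : measurable_fun setT f -> pm1_fun f ->
  risk P f = ((cube_hinge_star + cube_excess f) / 2)%:E.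
Proof.
move=> mf f1; set S := [set z : X * bool | f z.1 != lab z.2].
have SE : (\1_S : X * bool -> R) = (fun z => 2^-1 * hloss f z).
  apply/funext => -[y c]; rewrite indicE /hloss /=.
  have -> : ((y, c) \in S) = (f y != lab c).
    by apply/idP/idP; rewrite inE.
  have [->|->] := f1 y; case: c; rewrite /lab ?eqxx /=.
  - by rewrite max_l; lra.
  - by rewrite max_l ?gt_eqF//=; lra.
  - by rewrite max_l ?lt_eqF//=; lra.
  - by rewrite max_l; lra.
have mhl : measurable_fun setT (fun z => 2^-1 * hloss f z).
  apply: measurable_funM => //; apply: measurable_fun_label => c /=.
  apply: measurable_maxr => //; apply: measurable_funB => //.
  exact: measurable_funM.
have mS : measurable S by apply/(measurable_indicP R); rewrite SE.
rewrite /risk -/S -[LHS](_ : (\int[P]_z (\1_S z)%:E)%E = _); last first.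
  by rewrite integral_indic// setIT.
rewrite PE; [|by rewrite SE|by move=> z; rewrite indicE ler0n].
rewrite -(cube_hinge_eq f); last exact: pm1_unit_interval.
congr EFin; rewrite SE /atomsum mulr_suml; apply: eq_bigr => i _.
by field.
Qed.

Lemma risk_star_cube : risk_star P = (cube_hinge_star / 2)%:E.
Proof.
apply/eqP; rewrite eq_le; apply/andP; split.
  apply: ereal_inf_lbound; exists fb => //.
  by rewrite risk_cubeE ?cube_excess0 ?addr0.
apply: le_ereal_inf_tmp => _ [f [mf f1] <-].
rewrite risk_cubeE// lee_fin ler_wpM2r// lerDl; exact: cube_excess_ge0.
Qed.

Let eta := ptfun N.+1 e x.

Lemma fstar_cube j : (j <= N)%N ->
  fstar eta (x j) = if (j < N)%N then sgb (b j) else 1.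
Proof.
move=> jN; rewrite /fstar /eta ptfun_at// /e /cube_eta /sgb.
move: h0 => h0'; case: (j < N)%N; last by rewrite ifT//; lra.
by case: (b j); [rewrite ifF//; apply/negbTE; rewrite -ltNge|rewrite ifT//]; lra.
Qed.

Lemma measurable_fstar : measurable_fun setT (fstar eta).
Proof.
have meta : measurable_fun setT eta by exact: measurable_ptfun.
by apply: measurable_fun_ifT => //; exact: measurable_fun_ler.
Qed.

Lemma dist_cubeE (f : X -> R) : measurable_fun setT f ->
  dist_fstar P eta f = (cube_dist f)%:E.
Proof.
move=> mf; rewrite /dist_fstar PE//; last first.
  apply: measurable_fun_label => c /=; apply: measurableT_comp => //.
  by apply: measurable_funB => //; exact: measurable_fstar.
congr EFin; rewrite /atomsum /= (eq_bigr (fun i : 'I_N.+1 =>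
    mu i * `|f (x i) - (if (i < N)%N then sgb (b i) else 1)|)); last first.
  by move=> i _; rewrite fstar_cube; [ring|rewrite -ltnS ltn_ord].
rewrite (cube_sum (fun i => `|f (x i) - (if (i < N)%N then sgb (b i) else 1)|)).
by rewrite ltnn; congr (_ * _ + _); apply: eq_bigr => i _; rewrite ltn_ord.
Qed.

Variable k : R.
Hypothesis k1 : 1 <= k.
Hypothesis p3 : N%:R * w <= 3^-1.
Hypothesis pk : (N%:R * w) `^ k <= 3 / 2 * (N%:R * w * h).

(** This is [mah_ineq] with [p = N w], [t] the part of the distance carried by the [N] points and
    [u] the part at [x N]. Their upper bounds hold because each difference of values is at most
    2. *)
Lemma MAH_cube : MAH P eta k (mah_const k).
Proof.
move=> f mf f1; rewrite dist_cubeE// hinge_cubeE// hinge_star_cube /= lee_fin.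
rewrite addrAC subrr add0r /cube_dist /cube_excess.
have n2 (v : R) c : -1 <= v <= 1 -> `|v - sgb c| <= 2.
  by move=> v1; rewrite normB_sgb//; case: c; rewrite /sgb; lra.
apply: (mah_ineq _ (N%:R * w)) => //.
- by rewrite mulr_ge0.
- exact: ltW.
- rewrite mulr_ge0 ?sumr_ge0//= [leRHS]mulrA [leRHS]mulrC.
  rewrite ler_wpM2l//.
  have -> : 2 * N%:R = \sum_(j < N) (2 : R).
    by rewrite sumr_const card_ord mulr_natr.
  by apply: ler_sum => j _; exact: n2.
- rewrite mulr_ge0 ?subr_ge0//= mulrC ler_wpM2r ?subr_ge0//.
  exact: (n2 _ false).
Qed.

Lemma MA_cube : MA P eta k.
Proof.
exists (mah_const k * 2 `^ k^-1); split.
  by rewrite mulr_gt0 ?mah_const_gt0 ?powR_gt0.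
move=> f mf f1; apply: le_trans (MAH_cube f mf (pm1_unit_interval f f1)) _.
rewrite hinge_cubeE ?risk_cubeE//; last exact: pm1_unit_interval.
rewrite hinge_star_cube risk_star_cube /= lee_fin -mulrA -powRM//; last first.
  by have := cube_excess_ge0 f; lra.
rewrite le_eqVlt; apply/orP; left; apply/eqP; by congr (_ * _ `^ _); field.
Qed.

End CubeLaw.

(** * Choice of the parameters *)

Lemma lb_constE {R : realType} (k : R) : 1 <= k ->
  lb_const k (mah_const k) =
  3 / (8 * expR 1) * 2 `^ (k / (2 * k - 1) - 1) * ln 2 `^ (- (k / (2 * k - 1))).
Proof.
move=> k1; rewrite /lb_const mah_constE//; congr (_ * _).
have e0 : expR 1 != 0 :> R by rewrite gt_eqF// expR_gt0.
have k2 : 2 * k - 1 != 0 by rewrite gt_eqF//; lra.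
have -> : k / (2 * k - 1) - 1 = k - 1 - 2 * k * (k - 1) / (2 * k - 1) by field.
rewrite [in RHS]powRD; last by rewrite pnatr_eq0 implybT.
by field.
Qed.

(** Here [x] stands for [N / n], [r] for [log2 M / n] and [p] for the total mass [N w]. With
    [s = k / (2 k - 1)], the exponent [2 s - 1] is [1 / (2 k - 1)]. *)
Lemma cube_parameters_pos {R : realType} (k r x : R) : 1 <= k ->
  0 < x -> x <= 2^-1 -> 0 <= r -> r <= 2^-1 -> r <= 8 / 5 * x ->
  exists p h : R, [/\ 0 < p <= 3^-1, 0 < h <= 1, p * h ^+ 2 = 4 / 9 * x,
    p `^ k <= 3 / 2 * (p * h) &
    3 / (8 * expR 1) * 2 `^ (k / (2 * k - 1) - 1) * r `^ (k / (2 * k - 1))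
    <= p * h / 3].
Proof.
move=> k1 x0 x2 r0 r2 rx.
have e27 := @expR1_ge27 R.
have e0 : 0 < expR 1 :> R by exact: expR_gt0.
have k2 : 0 < 2 * k - 1 by lra.
have k20 : 2 * k - 1 != 0 by rewrite gt_eqF.
set s := k / (2 * k - 1).
have s1 : s <= 1 by rewrite /s ler_pdivrMr//; lra.
have s2 : 2^-1 <= s by rewrite /s ler_pdivlMr//; lra.
have xn0 : x != 0 by rewrite gt_eqF.
have twos : (2 : R) `^ (s - 1) = 2 `^ s / 2.
  by rewrite powRB ?powRr1// pnatr_eq0 implybT.
pose q := x `^ (2 * s - 1).
have q0 : 0 < q by exact: powR_gt0.
have [q3|q3] := leP q 3^-1.
  (* The testing constraint forces this [h]. Then [p]^ k[and](3/2) p h[both equal]x [^ s], so the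
     margin constraint is an equality. *)
  exists q, (2 / 3 * x `^ (1 - s)).
  have xs0 : 0 < x `^ (1 - s) by exact: powR_gt0.
  have xs1 : x `^ (1 - s) <= 1.
    rewrite -[leRHS](powRr0 x); apply: ger_powR; last by lra.
    by rewrite x0 /=; lra.
  have qx : q * x `^ (1 - s) = x `^ s.
    rewrite /q -powRD; last by rewrite xn0 implybT.
    by congr powR; lra.
  have qx2 : x `^ s * x `^ (1 - s) = x.
    rewrite -powRD; last by rewrite xn0 implybT.
    by rewrite addrC subrK powRr1// ltW.
  split.
  - by rewrite q0.
  - by rewrite mulr_gt0//=; lra.
  - rewrite exprMn mulrCA (expr2 (x `^ _)) [q * _]mulrA qx qx2; lra.
  - have -> : 3 / 2 * (q * (2 / 3 * x `^ (1 - s))) = x `^ s.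
      by rewrite -qx; field.
    rewrite /q -powRrM.
    by have -> : (2 * s - 1) * k = s by rewrite /s; field.
  - have -> : q * (2 / 3 * x `^ (1 - s)) / 3 = 2 / 9 * x `^ s.
      by rewrite -qx; field.
    have rs : r `^ s <= 8 / 5 * x `^ s.
      apply: (@le_trans _ _ ((8 / 5 * x) `^ s)).
        by apply: ge0_ler_powR; rewrite ?nnegrE//; lra.
      rewrite powRM ?(ltW x0)//.
      rewrite ler_wpM2r ?powR_ge0//.
      by rewrite ler1_powR//; lra.
    have t1 : (2 : R) `^ (s - 1) <= 1.
      by rewrite -[leRHS](powRr0 2); apply: ler_powR; lra.
    have rs0 : 0 <= r `^ s by exact: powR_ge0.
    have A : 2 `^ (s - 1) * r `^ s <= 8 / 5 * x `^ s.
      by apply: le_trans rs; rewrite ler_piMl.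
    have xs : 0 <= x `^ s by exact: powR_ge0.
    (* The constants reduce to [3 / (5 e) <= 2/9], which is exactly [e >= 27/10]. *)
    rewrite -mulrA; apply: (@le_trans _ _ (3 / (8 * expR 1) * (8 / 5 * x `^ s))).
      by rewrite ler_wpM2l// divr_ge0//; lra.
    have -> : 3 / (8 * expR 1) * (8 / 5 * x `^ s) = 3 * x `^ s / (5 * expR 1).
      by field; rewrite gt_eqF.
    rewrite ler_pdivrMr; last by lra.
    have := ler_wpM2l xs e27; nra.
(* When the mass is capped at [1/3], the testing constraint gives [h ^+ 2 = (4/3) x], at most [2/3]
   because [x <= 1/2]. *)
exists 3^-1, (Num.sqrt (4 / 3 * x)).
have h2 : Num.sqrt (4 / 3 * x) ^+ 2 = 4 / 3 * x by rewrite sqr_sqrtr//; lra.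
have h0 : 0 < Num.sqrt (4 / 3 * x) by rewrite sqrtr_gt0; lra.
split.
- by rewrite invr_gt0 ltr0n lexx.
- rewrite h0 -(@ler_pXn2r _ 2) ?nnegrE ?(ltW h0)//= h2 expr1n; lra.
- by rewrite h2; lra.
- set h := Num.sqrt _ in h2 h0 *.
  have kk : 0 < (3^-1 : R) `^ k by rewrite powR_gt0 ?invr_gt0.
  suff : 2 * 3^-1 `^ k <= h by lra.
  rewrite -(@ler_pXn2r _ 2) ?nnegrE ?(ltW h0)//.
  rewrite h2 exprMn.
  have -> : ((3^-1 : R) `^ k) ^+ 2 = 3^-1 `^ (2 * k - 1) * 3^-1.
    rewrite -powR_mulrn ?powR_ge0// -powRrM (mulrC k).
    rewrite -[X in _ = _ * X](@powRr1 _ 3^-1) ?invr_ge0// -powRD ?subrK//.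
    by rewrite invr_eq0 pnatr_eq0 implybT.
  suff : (3^-1 : R) `^ (2 * k - 1) <= x by lra.
  have -> : x = q `^ (2 * k - 1).
    rewrite /q -powRrM.
    have -> : (2 * s - 1) * (2 * k - 1) = 1 by rewrite /s; field.
    by rewrite powRr1// ltW.
  by apply: ge0_ler_powR; rewrite ?nnegrE ?invr_ge0 ?(ltW k2) ?(ltW q0) ?(ltW q3).
- set h := Num.sqrt _ in h2 h0 *.
  (* Since [2 r <= 1] and [s >= 1/2], the power [s] of [2 r] is at most its square root, and
     [2 r <= (16/5) x]. *)
  have rs : 2 `^ s * r `^ s <= Num.sqrt (16 / 5 * x).
    rewrite -powRM// -powR12_sqrt; last by lra.
    have [->|r0'] := eqVneq r 0.
      by rewrite mulr0 powR0 ?powR_ge0// gt_eqF//; lra.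
    apply: (@le_trans _ _ ((2 * r) `^ 2^-1)).
      apply: ger_powR s2; rewrite mulr_gt0 ?lt0r ?r0' ?r0//=; lra.
    by apply: ge0_ler_powR; rewrite ?nnegrE; lra.
  rewrite twos; set g := Num.sqrt _ in rs *.
  have g0 : 0 <= g by exact: sqrtr_ge0.
  have g2 : g ^+ 2 = 16 / 5 * x by rewrite sqr_sqrtr//; lra.
  set y := 2 `^ s in rs *; set z := r `^ s in rs *.
  have gh : 3 * g <= 16 / 9 * (27 / 10) * h.
    rewrite -(@ler_pXn2r _ 2) ?nnegrE ?mulr_ge0 ?(ltW h0)//.
    by rewrite !exprMn h2 g2; lra.
  have -> : 3 / (8 * expR 1) * (y / 2) * z = 3 * (y * z) / (16 * expR 1).
    by field; rewrite gt_eqF.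
  rewrite ler_pdivrMr; last by lra.
  have := ler_wpM2l (ltW h0) e27; lra.
Qed.

Lemma cube_parameters {R : realType} (k : R) (M n : nat) :
  1 <= k -> (1 <= M)%N -> (2 : R) * (ln (M%:R : R) / ln 2) <= n%:R ->
  let N := trunc_log 2 M in
  exists w h : R, [/\ 0 <= w, N%:R * w <= 3^-1, 0 < h <= 1,
    n%:R * (w * h ^+ 2) <= 4 / 9 &
    (N%:R * w) `^ k <= 3 / 2 * (N%:R * w * h) /\
    lb_const k (mah_const k) * (ln (M%:R : R) / n%:R) `^ (k / (2 * k - 1))
      <= N%:R * w * h / 3].
Proof.
move=> k1 M1 Mn N.
have k2 : 0 < 2 * k - 1 by lra.
have s0 : k / (2 * k - 1) != 0 by rewrite gt_eqF// divr_gt0//; lra.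
have [M1'|M2] := leqP M 1.
  have M_1 : M = 1%N by apply/eqP; rewrite eqn_leq M1' M1.
  (* For [M = 1] there are no cube points and [ln M = 0], so both sides of the last bound vanish,
     also when [n = 0]. *)
  exists 0, 1; rewrite /N M_1 trunc_log1 ln1 !mul0r !powR0 ?mulr0 ?mul0r//.
    by split; rewrite ?ltr01 ?lexx//; lra.
  by rewrite gt_eqF//; lra.
have l2 : 0 < ln 2 :> R by rewrite ln_gt0//; lra.
have N0 : (0 < N)%N by rewrite /N trunc_log_gt0.
have NR : 0 < N%:R :> R by rewrite ltr0n.
have NlM : N%:R * ln 2 <= ln (M%:R : R).
  rewrite mulr_natl -lnXn// -natrX ler_ln ?posrE ?ltr0n ?expn_gt0//.
  by rewrite ler_nat trunc_logP.
have MlN : 5 * ln (M%:R : R) <= 8 * N%:R * ln 2.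
  have : ln ((M ^ 5)%:R : R) <= ln ((2 ^ (8 * N))%:R : R).
    rewrite ler_ln ?posrE ?ltr0n ?expn_gt0 ?M1// ler_nat.
    exact: leq_pow_trunc_log.
  by rewrite !natrX !lnXn ?ltr0n// -[leLHS]mulr_natl -[leRHS]mulr_natl natrM.
have n0 : 0 < n%:R :> R.
  apply: lt_le_trans Mn; rewrite mulr_gt0// divr_gt0//.
  by apply: lt_le_trans NlM; rewrite mulr_gt0.
have Mn' : 2 * ln (M%:R : R) <= n%:R * ln 2.
  by move: Mn; rewrite mulrA ler_pdivrMr.
have [|||||p [h [/andP[p0 p3] /andP[h0 h1] ph pk lb]]] :=
  @cube_parameters_pos R k (ln (M%:R : R) / (ln 2 * n%:R)) (N%:R / n%:R) k1.
- by rewrite divr_gt0.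
- rewrite ler_pdivrMr// -(ler_pM2r l2); lra.
- by rewrite divr_ge0 ?mulr_ge0 ?(ltW l2) ?(ltW n0)// ln_ge0// ler1n.
- by rewrite ler_pdivrMr ?mulr_gt0//; lra.
- rewrite ler_pdivrMr ?mulr_gt0//.
  have -> : 8 / 5 * (N%:R / n%:R) * (ln 2 * n%:R) = 8 / 5 * N%:R * ln 2 :> R.
    by field; rewrite gt_eqF.
  by lra.
have Np : N%:R * (p / N%:R) = p by field; rewrite gt_eqF.
exists (p / N%:R), h; rewrite Np; split => //.
- by rewrite divr_ge0 ?(ltW p0) ?(ltW NR).
- by rewrite h0.
- have -> : n%:R * (p / N%:R * h ^+ 2) = n%:R / N%:R * (p * h ^+ 2) by ring.
  by rewrite ph le_eqVlt; apply/orP; left; apply/eqP; field; rewrite !gt_eqF.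
split => //; apply: le_trans lb.
rewrite lb_constE//.
set s := k / (2 * k - 1).
(* The power of [ln 2] in the constant converts the natural logarithm of [M] into [log2 M]. *)
have -> : ln (M%:R : R) / n%:R = ln 2 * (ln (M%:R : R) / (ln 2 * n%:R)).
  by field; rewrite !gt_eqF.
rewrite powRM ?(ltW l2)//; last first.
  by rewrite divr_ge0 ?mulr_ge0 ?(ltW l2) ?(ltW n0)// ln_ge0// ler1n.
rewrite mulrA -[X in X * _ <= _]mulrA -powRD ?addNr ?powRr0 ?mulr1//.
by rewrite (gt_eqF l2) implybT.
Qed.

(** * The rules *)

Definition bit (i k : nat) : bool := odd (iter i half k).

Lemma bit_inj n a b : (a < 2 ^ n)%N -> (b < 2 ^ n)%N ->
  (forall i, (i < n)%N -> bit i a = bit i b) -> a = b.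
Proof.
elim: n a b => [|n IH] a b; first by rewrite expn0 !ltnS !leqn0 => /eqP-> /eqP->.
rewrite expnS mul2n => an bn ab.
have ab0 : odd a = odd b by apply: (ab 0%N).
rewrite -(odd_double_half a) -(odd_double_half b) ab0; congr (_ + _.*2)%N.
apply: IH => [||i iN]; first by rewrite -ltn_double; lia.
  by rewrite -ltn_double; lia.
by have := ab i.+1 iN; rewrite /bit !iterSr.
Qed.

(** Staying below [2 ^ n] makes the digit in position [n] zero, so the corresponding rule takes the
    value 1 at the extra point [x N]. *)
Lemma bit_surj n (f : nat -> bool) : exists2 k, (k < 2 ^ n)%N &
  (forall i, (i < n)%N -> bit i k = f i) /\ bit n k = false.
Proof.
elim: n f => [|n IH] f; first by exists 0%N.
have [k kn [kf k0]] := IH (fun i => f i.+1).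
exists (f 0%N + k.*2)%N.
  by rewrite expnS mul2n; case: (f 0%N); lia.
have hk i : bit i.+1 (f 0%N + k.*2)%N = bit i k.
  by rewrite /bit iterSr half_bit_double.
split; last by rewrite hk.
case=> [_|i iN]; last by rewrite hk; exact: kf.
by rewrite /bit /= oddD odd_double addbF oddb.
Qed.

(** The binary digits of [k] are the signs. Position [N] is included because [M] may exceed [2 ^ N]
    but not [2 ^ N.+1], so [N + 1] points keep the [M] rules distinct. *)
Definition cube_rule {R : realType} {X : Type} (N : nat) (x : nat -> X) (k : nat)
    (y : X) : R := 1 - 2 * ptfun N.+1 (fun i => (bit i k : nat)%:R) x y.

Lemma cube_rule_at {R : realType} {X : Type} N (x : nat -> X) k i :
  injective x -> (i <= N)%N -> cube_rule N x k (x i) = sgb (bit i k) :> R.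
Proof.
move=> xinj iN; rewrite /cube_rule ptfun_at// /sgb.
by case: (bit i k) => /=; lra.
Qed.

Lemma pm1_cube_rule {R : realType} {d} {X : measurableType d} N (x : nat -> X) k :
  injective x -> pm1_fun (cube_rule N x k : X -> R).
Proof.
move=> xinj y; rewrite /cube_rule.
have [[i _ [_ ->]]|[_ ->]] :=
  @ptfun_cases R X N.+1 (fun i => (bit i k : nat)%:R) x y xinj.
  by case: (bit i k) => /=; [right|left]; lra.
by left; lra.
Qed.

Lemma measurable_cube_rule {R : realType} {d} {X : measurableType d} N
    (x : nat -> X) k : (forall y : X, measurable [set y]) ->
  measurable_fun setT (cube_rule N x k : X -> R).
Proof.
move=> mX; apply: measurable_funB => //; apply: measurable_funM => //.
exact: measurable_ptfun.
Qed.

Lemma conv_hull_vertex {R : realType} {X : Type} M (F : 'I_M -> X -> R) j :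
  conv_hull F (F j).
Proof.
exists (fun i => (i == j)%:R); split => [i|]; first exact: ler0n.
split; first by rewrite (bigD1 j)//= eqxx big1 ?addr0// => i /negbTE ->.
apply/funext => y; rewrite (bigD1 j)//= eqxx mul1r big1 ?addr0// => i /negbTE ->.
by rewrite mul0r.
Qed.

(** * The lower bound against the convex hull *)

Lemma infinite_injection (T : Type) :
  infinite_set [set: T] -> exists x : nat -> T, injective x.
Proof.
move=> /infiniteP/card_leP[f].
exists (fun n => set_val (f (to_setT n))) => i j /val_inj/inj.
by rewrite !inE => /(_ I I) [].
Qed.

Theorem theorem2 (R : realType) (kappa : R) : 1 <= kappa ->
  exists c : R, 0 < c /\
  forall (d : measure_display) (X : measurableType d),
    infinite_set [set: X] ->
    (forall x : X, measurable [set x]) ->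
  forall M n : nat, (1 <= M)%N ->
    (2 : R) * (ln (M%:R : R) / ln 2) <= n%:R ->
  exists F : 'I_M -> X -> R,
    injective F /\
    (forall j, measurable_fun setT (F j) /\ pm1_fun (F j)) /\
  forall fbar : X -> n.-tuple (X * bool) -> R,
    measurable_fun setT (fun p : X * n.-tuple (X * bool) => fbar p.1 p.2) ->
  exists (P : probability (X * bool)%type R) (eta : X -> R),
    is_eta P eta /\ MA P eta kappa /\ MAH P eta kappa c /\
    let minC := fine (ereal_inf [set (hinge P f - hinge_star P)%E | f in conv_hull F]) in
    (sampleE P (fun D => hinge P (fun x => fbar x D) - hinge_star P)%E >=
     (minC + lb_const kappa c *
        (Num.sqrt (minC `^ kappa^-1 * ln (M%:R : R) / n%:R)
         + (ln (M%:R : R) / n%:R) `^ (kappa / (2 * kappa - 1))))%:E)%E.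
Proof.
move=> k1; exists (mah_const kappa); split; first exact: mah_const_gt0.
move=> d X Xinf mX M n M1 Mn.
have [x xinj] := infinite_injection X Xinf.
have [w [h [w0 Nw3 h01 nwh [pk lb]]]] := cube_parameters kappa M n k1 M1 Mn.
set N := trunc_log 2 M in Nw3 pk lb *.
have /andP[h0 h1] := h01.
have Nw : N%:R * w <= 1 by lra.
have /andP[NM MN] := trunc_log_bounds (isT : 1 < 2)%N M1.
pose F (j : 'I_M) : X -> R := cube_rule N x j.
have mF j : measurable_fun setT (F j) by exact: measurable_cube_rule.
have F1 j : pm1_fun (F j) by exact: pm1_cube_rule.
exists F; split.
  move=> i j Fij; apply/val_inj.
  apply: (bit_inj N.+1) => [||l lN]; try exact: leq_trans (ltn_ord _) (ltnW MN).
  have : F i (x l) = F j (x l) by rewrite Fij.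
  rewrite /F !cube_rule_at// /sgb.
  by case: (bit l i); case: (bit l j) => // H; lra.
split => // fbar _.
have h01' : 0 <= h <= 1 by rewrite ltW.
(* The hidden pattern, and with it the law, is chosen against the given procedure. *)
have [b bP] := assouad N n w h x fbar w0 Nw h01' nwh.
have mu0 i := cube_mass_ge0 N w i w0 Nw.
have e01 i := cube_eta01 N h b i h01'.
have [P PE] := atom_probability N.+1 (cube_mass N w) (cube_eta N h b) x mu0 e01
  (sum_cube_mass1 N w).
(* The digits of [k] spell the hidden pattern, and [k < 2 ^ N <= M], so rule number [k] is the Bayes
   rule on the atoms. *)
have [k kN [kb k0]] := bit_surj N b.
pose j : 'I_M := Ordinal (leq_trans kN NM).
have Fj i : (i < N)%N -> F j (x i) = sgb (b i).
  by move=> iN; rewrite /F cube_rule_at ?(ltnW iN)//= kb.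
have FN : F j (x N) = 1 by rewrite /F cube_rule_at//= k0.
exists P, (ptfun N.+1 (cube_eta N h b) x); split.
  exact: (is_eta_atom N.+1 (cube_mass N w) (cube_eta N h b)).
split; first exact: (MA_cube N w h b x P mX xinj w0 Nw h0 h1 PE (F j)).
split; first exact: (MAH_cube N w h b x P mX xinj w0 Nw h0 h1 PE (F j)).
have hs := hinge_star_cube N w h b x P mX xinj w0 Nw h0 h1 PE (F j) (mF j) (F1 j)
  Fj FN.
have -> : ereal_inf [set (hinge P f - hinge_star P)%E | f in conv_hull F] = 0%E.
  apply/eqP; rewrite eq_le; apply/andP; split.
    apply: ereal_inf_lbound; exists (F j); first exact: conv_hull_vertex.
    rewrite (hinge_cubeE N w h b x P PE)//; last first.
      exact: pm1_unit_interval.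
    by rewrite hs cube_excess0// addr0 subee.
  apply: le_ereal_inf_tmp => _ [f Ff <-].
  rewrite hs sube_ge0//.
  exact: (cube_hinge_ge_star N w h b x P mX xinj w0 Nw h0 h1 PE).
(* The approximation error is 0 and [kappa^-1] is nonzero, so the square-root term vanishes. *)
rewrite /= powR0; last by rewrite invr_eq0 gt_eqF//; lra.
rewrite !mul0r sqrtr0 !add0r.
apply: (@le_trans _ _ (N%:R * w * h / 3)%:E); first by rewrite lee_fin.
apply: le_trans (atomE_le_sampleE N.+1 (cube_mass N w) (cube_eta N h b) x P mX
  xinj mu0 e01 PE n _ _ _ _); first by rewrite lee_fin; exact: bP.
  move=> t; apply: sumr_ge0 => i _; rewrite !mulr_ge0 ?(ltW h0)//.
  by rewrite le_max lexx orbT.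
(* For each fixed sample, the excess hinge risk dominates the loss from [assouad]; the subtraction
   is harmless because the optimal hinge risk is finite. *)
move=> t; rewrite hs leeBrDr//.
apply: le_trans (hinge_atom_ge N.+1 (cube_mass N w) (cube_eta N h b) x P mX
  xinj PE _); rewrite -EFinD lee_fin addrC.
exact: (cube_hinge_ge N w h b x w0 Nw h0 h1 (fun y => fbar y t)).
Qed.
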